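(* Let $q$ be a prime power, let $c$ be an element of a finite extension of $\mathbb{F}_q$ satisfying $c^2+c=1$ (with $c\in\mathbb{F}_{q^6}$), and consider the set of $q$-polynomials \[\mathcal{C}=\langle x,\; x^q+x^{q^3}+c\,x^{q^5}\rangle_{\mathbb{F}_{q^6}}=\{a x+b(x^q+x^{q^3}+c x^{q^5})\colon a,b\in\mathbb{F}_{q^6}\}\subseteq \mathcal{L}_{6,q}.\] Then $\mathcal{C}$ is an $\mathbb{F}_q$-linear MRD-code of $\mathcal{L}_{6,q}$ with dimension $12$ over $\mathbb{F}_q$, minimum distance $5$, left idealiser isomorphic to $\mathbb{F}_{q^6}$ and right idealiser isomorphic to $\mathbb{F}_{q^2}$ if and only if $q$ is odd. Moreover, when $q$ is odd and $q\equiv \pm 2 \pmod 5$, $\mathcal{C}$ is not equivalent to any of the previously known $\mathbb{F}_q$-linear MRD-codes of $\mathcal{L}_{6,q}$ with dimension $12$, minimum distance $5$ and left idealiser isomorphic to $\mathbb{F}_{q^6}$, namely the codes $\langle x, g(x)\rangle_{\mathbb{F}_{q^6}}$ with $g(x)=x^{q^s}$ ($\gcd(s,6)=1$), or $g(x)=\delta x^{q^s}+x^{q^{6-s}}$ ($\gcd(s,6)=1$, $\mathrm{N}_{q^6/q}(\delta)\notin\{0,1\}$), or $g(x)=\delta x^{q^s}+x^{q^{s+3}}$ ($\gcd(s,3)=1$, $\mathrm{N}_{q^6/q^3}(\delta)\notin\{0,1\}$, and $\delta,q$ such that this code is MRD).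
   Context: $\mathcal{L}_{6,q}$ denotes the $\mathbb{F}_q$-algebra of $q$-polynomials $\sum_{i=0}^{5}a_ix^{q^i}$ with $a_i\in\mathbb{F}_{q^6}$ (taken modulo $x^{q^6}-x$), identified with $\mathbb{F}_q$-linear endomorphisms of $\mathbb{F}_{q^6}$, with addition, composition and $\mathbb{F}_q$-scalar multiplication. The rank of $f$ is its rank as an $\mathbb{F}_q$-linear map, and the rank distance is $d(f,g)=\mathrm{rk}(f-g)$. An $\mathbb{F}_q$-linear rank-distance (RD) code is an $\mathbb{F}_q$-subspace $\mathcal{C}$ of $\mathcal{L}_{6,q}$; its minimum distance is $d=\min\{d(f,g)\colon f\ne g\in\mathcal{C}\}$; it is MRD if $|\mathcal{C}|=q^{6(6-d+1)}$. The left idealiser is $L(\mathcal{C})=\{\varphi\in\mathcal{L}_{6,q}\colon \varphi\circ f\in\mathcal{C}\ \forall f\in\mathcal{C}\}$ and the right idealiser is $R(\mathcal{C})=\{\varphi\in\mathcal{L}_{6,q}\colon f\circ\varphi\in\mathcal{C}\ \forall f\in\mathcal{C}\}$. Two $\mathbb{F}_q$-linear codes $\mathcal{C}_1,\mathcal{C}_2$ are equivalent if there exist invertible $\varphi_1,\varphi_2\in\mathcal{L}_{6,q}$ and $\rho\in\mathrm{Aut}(\mathbb{F}_{q^6})$ with $\varphi_1\circ f^\rho\circ\varphi_2\in\mathcal{C}_2$ for all $f\in\mathcal{C}_1$, where $f^\rho(x)=\sum a_i^\rho x^{q^i}$. $\mathrm{N}_{q^6/q^k}$ denotes the field norm from $\mathbb{F}_{q^6}$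 to $\mathbb{F}_{q^k}$. *)

(* Defs.v *)
From HB Require Import structures.
From mathcomp Require Import all_boot all_order all_algebra all_fingroup all_solvable all_field.

Set Implicit Arguments.
Unset Strict Implicit.
Unset Printing Implicit Defensive.

Import GRing.Theory.
Local Open Scope ring_scope.

(* F plays the role of F_q (q = #|F|) and L that of F_{q^n} (n = \dim {:L}).
   The algebra of q-polynomials modulo x^{q^n} - x is identified with 'End(L);
   see qpoly_inj and qpoly_surj.  finvect_type 'End(L) is 'End(L) with its canonical
   finType structure, so that codes are finite sets with a cardinality. *)
Notation rdcode L := {set finvect_type 'End(L)}.

Section QPolynomials.

Variables (F : finFieldType) (L : fieldExtType F).
Implicit Types (f g phi : 'End(L)) (C D : rdcode L).

(* The monomial x^{q^i}; F-linear, see qmonomE. *)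
Definition qmonom (i : nat) : 'End(L) := linfun (fun x : L => x ^+ (#|F| ^ i)).

(* a f(x), where amull a is x |-> a * x. *)
Definition lscale (a : L) f : 'End(L) := (amull a \o f)%VF.

Definition qpoly (a : 'I_(\dim {:L}) -> L) : 'End(L) :=
  \sum_i lscale (a i) (qmonom i).

Definition Lspan2 f g : rdcode L :=
  [set (lscale a f + lscale b g : finvect_type 'End(L))
     | a : finvect_type L in setT, b : finvect_type L in setT].

Definition rank f : nat := \dim (limg f).
Definition rdist f g : nat := rank (f - g).

Definition Fq_linear C : Prop := submod_closed (C : {pred 'End(L)}).

(* For F-linear C the span is C itself. *)
Definition code_dim C : nat := \dim <<enum C : seq 'End(L)>>%VS.

Definition is_min_dist C (d : nat) : Prop :=
  (exists f g, [/\ f \in C, g \in C, f != g & rdist f g = d]) /\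
  (forall f g, f \in C -> g \in C -> f != g -> (d <= rdist f g)%N).

Definition is_MRD C : Prop :=
  exists2 d, is_min_dist C d
    & #|C| = (#|F| ^ (\dim {:L} * (\dim {:L} - d + 1)))%N.

Definition left_idealiser C : rdcode L :=
  [set phi : finvect_type 'End(L) | [forall f in C, (phi \o f)%VF \in C]].

Definition right_idealiser C : rdcode L :=
  [set phi : finvect_type 'End(L) | [forall f in C, (f \o phi)%VF \in C]].

(* A, a subset of 'End(L), is an F-algebra under composition isomorphic to K. *)
Definition alg_isomorphic (A : rdcode L) (K : fieldExtType F) : Prop :=
  exists h : {linear K -> 'End(L)},
    [/\ injective h, h 1 = \1%VF,
        forall x y, h (x * y) = (h x \o h y)%VF
      & forall phi, phi \in A <-> exists x, h x = phi].

(* The twist f^rho is computed on the coefficients of f; rho is any field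
   automorphism of L, not necessarily fixing F. *)
Definition equivalent C D : Prop :=
  exists (phi1 phi2 : 'End(L)) (rho : {rmorphism L -> L}),
    [/\ bijective phi1, bijective phi2, bijective rho
      & forall a : 'I_(\dim {:L}) -> L, qpoly a \in C ->
          (phi1 \o qpoly (rho \o a) \o phi2)%VF \in D].

Let frob_linear i : linear (fun x : L => x ^+ (#|F| ^ i)).
Proof.
elim: i => [|i IHi] k u v; first by rewrite expn0 !expr1.
rewrite expnSr !exprM IHi exprDn_pchar; last first.
  have [p _ pcharFp] := finPcharP F; rewrite (card_pprimeChar pcharFp).
  rewrite pnatX; apply/orP; left.
  by rewrite pnatE ?(pcharf_prime pcharFp) // pchar_lalg.
by rewrite exprZn expf_card.
Qed.

Lemma qmonomE i x : qmonom i x = x ^+ (#|F| ^ i).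
Proof.
pose f := HB.pack_for {linear L -> L} (fun x : L => x ^+ (#|F| ^ i))
  (GRing.isLinear.Build F L L _ (fun x : L => x ^+ (#|F| ^ i)) (@frob_linear i)).
by rewrite /qmonom (lfunE f).
Qed.

Lemma qpolyE a x : qpoly a x = \sum_i a i * x ^+ (#|F| ^ i).
Proof.
rewrite /qpoly sum_lfunE; apply: eq_bigr => i _.
by rewrite comp_lfunE lfunE /= qmonomE.
Qed.

Lemma Lspan2P f g phi :
  reflect (exists a b, phi = lscale a f + lscale b g) (phi \in Lspan2 f g).
Proof.
apply: (iffP imset2P) => [[a b _ _ ->]|[a [b ->]]]; first by exists a, b.
by exists a b; rewrite ?inE.
Qed.

Let card_fin (vT : vectType F) : #|finvect_type vT| = (#|F| ^ \dim {:vT})%N.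
Proof.
have <- := @card_vspace F (finvect_type vT) (Vector.class vT) fullv.
by apply: eq_card => v; rewrite (memvf (v : vT)).
Qed.

Lemma qpoly_inj a b : qpoly a = qpoly b -> a =1 b.
Proof.
move=> eq_ab; have q_gt1 : (1 < #|F|)%N := finNzRing_gt1 F.
pose p : {poly L} := \sum_i (a i - b i) *: 'X^(#|F| ^ i).
have p0 : p = 0.
  apply: (@roots_geq_poly_eq0 L _ (enum (finvect_type L))).
  - apply/allP=> x _; apply/rootP; rewrite horner_sum.
    under eq_bigr do rewrite hornerZ hornerXn mulrBl.
    by rewrite sumrB -!qpolyE eq_ab subrr.
  - exact: (@enum_uniq (finvect_type L)).
  rewrite -(@cardE (finvect_type L)) card_fin; apply: leq_trans (size_sum _ _ _) _.
  apply/bigmax_leqP=> i _; apply: leq_trans (size_scale_leq _ _) _.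
  by rewrite size_polyXn ltn_exp2l.
move=> i; apply/eqP; rewrite -subr_eq0; apply/eqP.
rewrite -[RHS](coef0 L (#|F| ^ i)) -p0 coef_sum (bigD1 i) //= big1 => [|j ji].
  by rewrite coefZ coefXn eqxx mulr1 addr0.
by rewrite coefZ coefXn eqn_exp2l // eq_sym (inj_eq val_inj) (negPf ji) mulr0.
Qed.

Lemma qpoly_surj phi : exists a, phi = qpoly a.
Proof.
pose h (a : {ffun 'I_(\dim {:L}) -> finvect_type L}) : finvect_type 'End(L) :=
  qpoly a.
have h_inj : injective h by move=> a b /qpoly_inj ab; apply/ffunP.
have /codomP[a ->] : (phi : finvect_type 'End(L)) \in codom h.
  apply: inj_card_onto => //.
  rewrite card_ffun card_ord !card_fin -expnM.
  by rewrite !dimvf.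
by exists a.
Qed.

End QPolynomials.

(* Main.v *)
Require Import Defs.
From HB Require Import structures.
From mathcomp Require Import all_boot all_order all_algebra all_fingroup all_solvable all_field.
From mathcomp Require Import ring.

(* Write [x_i] for [x^(q^i)], let [f x = x_1 + x_3 + c x_5] and [d = c^q]; then [d] is
   [c] or [- 1 - c].

   The code has minimum distance 5 iff [f x = m x] has at most a line of solutions over
   [F_q] for every [m].  For [m != 0] put [k = 1 / m].  Substituting [f x = m x] into itself
   gives, for each solution [x], a relation [A x_2 + E x_4 = B x] with
   [A = k_1 + d k_3 + c k_5] and [E = k_1 + k_3 + c d k_5].  For two solutions [x], [y] the
   determinant [p = x y_2 - y x_2] then satisfies [A p = E p_4], so either [p = 0], which
   forces [y / x] into [F_q], or [A] and [E] have the same norm to [F_(q^2)].  The difference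
   of these norms is a constant times a product of conjugates of [k_3 - e k_1], where [e] is
   [- 1] or [c ^ 2]; in odd characteristic the constant is nonzero, and [k_3 = e k_1] is
   impossible because [e^3 != 1].

   If [q] is even, [c] is a primitive cube root of unity.  When [d = c], the equation
   [f x = c x] is solved by [1] and by any [y] with [y^(q-1) = c]; otherwise, for
   [k^(q+1) = c] the map [k f] is an involution, and so [1 + k f] has rank at most 3.

   Comparing left idealisers shows that an equivalence onto [<x, g>] may be assumed to be
   right composition with a nonzero [phi] in [<x, g>] such that [f' (phi x)] is in [<x, g>],
   [f'] being a conjugate of [f]; for the listed [g] this contradicts the uniqueness of the
   coefficients of a q-polynomial. *)

Set Implicit Arguments.
Unset Strict Implicit.
Unset Printing Implicit Defensive.

Import GRing.Theory.
Local Open Scope ring_scope.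

(** * Norm differences in a ring where [c^2 + c = 1] *)

Section Identities.

Variables (R : comNzRingType) (c u v w : R).
Hypothesis hc : c ^+ 2 + c = 1.

Let c2 : c ^+ 2 = 1 - c. Proof. by rewrite -hc addrK. Qed.

(* With [u, v, w = k_1, k_3, k_5], the left-hand sides below are the difference of the
   norms of [A] and [E] when [c^q] is [c], respectively [- 1 - c]. *)
Lemma prod_diff_fixed :
  (u + c * v + c * w) * (v + c * w + c * u) * (w + c * u + c * v)
  - (u + v + c * c * w) * (v + w + c * c * u) * (w + u + c * c * v)
  = (6%:R * c - 4%:R) * ((u + v) * (v + w) * (w + u)).
Proof. by ring: c2. Qed.

Lemma prod_diff_moved (d := - 1 - c) :
  (u + d * v + c * w) * (v + d * w + c * u) * (w + d * u + c * v)
  - (u + v + c * d * w) * (v + w + c * d * u) * (w + u + c * d * v)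
  = - (1 + c) ^+ 3 * ((v - c ^+ 2 * u) * (w - c ^+ 2 * v) * (u - c ^+ 2 * w)).
Proof. by rewrite /d; ring: c2. Qed.

End Identities.

(** * Frobenius powers, the trinomial, and q-polynomials for [n = 6] *)

Section Frobenius.

Variables (F : finFieldType) (L : fieldExtType F).

(** A plain function rather than a linear map, so that it can be declared a ring morphism and pushed
    through products. *)
Definition fr (i : nat) (x : L) : L := x ^+ (#|F| ^ i).

Lemma fr_qmonom i : fr i =1 qmonom L i.
Proof. by move=> x; rewrite qmonomE. Qed.

Fact fr_zmod i : zmod_morphism (fr i).
Proof. by move=> x y; rewrite !fr_qmonom linearB. Qed.
Fact fr_monoid i : monoid_morphism (fr i).
Proof. by split=> [|x y]; rewrite /fr ?expr1n // exprMn. Qed.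
HB.instance Definition _ i := GRing.isZmodMorphism.Build L L (fr i) (fr_zmod i).
HB.instance Definition _ i := GRing.isMonoidMorphism.Build L L (fr i) (fr_monoid i).

Lemma fr0 x : fr 0 x = x.
Proof. by rewrite /fr expn0 expr1. Qed.

Lemma frD i j x : fr i (fr j x) = fr (j + i) x.
Proof. by rewrite /fr -exprM expnD. Qed.

Lemma fr_dim x : fr (\dim {:L}) x = x.
Proof. by apply/eqP; rewrite -Fermat's_little_theorem memvf. Qed.

Lemma fr1_mem x : fr 1 x = x -> exists k : F, x = k%:A.
Proof.
move=> e; have /vlineP[k ->] : x \in 1%AS.
  by rewrite Fermat's_little_theorem dimv1; apply/eqP.
by exists k.
Qed.

Lemma fr_eq0 i x : (fr i x == 0) = (x == 0).
Proof. exact: fmorph_eq0. Qed.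

(** [#|F|] is a positive power of the characteristic, so both sides say that the characteristic is
    not 2. *)
Lemma two_neq0 : (2%:R != 0 :> L) = odd #|F|.
Proof.
have [p p_pr pF] := finPcharP F.
have pL : p \in [pchar L] by rewrite pchar_lalg.
have n0 : logn p #|pPrimeCharType pF| != 0%N.
  apply/eqP=> n0; have := card_pprimeChar pF; rewrite n0 expn0 => F1.
  by have : (1 < #|pPrimeCharType pF|)%N := finNzRing_gt1 F; rewrite F1.
rewrite -(dvdn_pcharf pL) (card_pprimeChar pF) oddX (negPf n0) /=.
by rewrite dvdn_prime2 //; have [->|/[dup] p_odd ->] := even_prime p_pr;
   last case: eqP p_odd => // ->.
Qed.

Definition trinom (c : L) : 'End(L) := qmonom L 1 + qmonom L 3 + lscale c (qmonom L 5).

Lemma trinomE c x : trinom c x = fr 1 x + fr 3 x + c * fr 5 x.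
Proof. by rewrite /trinom !add_lfunE comp_lfunE lfunE /= -!fr_qmonom. Qed.

(** The Frobenius permutes the roots of [X^2 + X - 1], which are [c] and [- 1 - c]. *)
Lemma golden_fr c : c ^+ 2 + c = 1 -> fr 1 c = c \/ fr 1 c = - 1 - c.
Proof.
move=> hc; have hd : fr 1 c ^+ 2 + fr 1 c = 1 by rewrite -rmorphXn -rmorphD hc rmorph1.
have /eqP : (fr 1 c - c) * (fr 1 c - (- 1 - c)) = 0.
  by transitivity (fr 1 c ^+ 2 + fr 1 c - (c ^+ 2 + c)); [ring | rewrite hd hc subrr].
by rewrite mulf_eq0 !subr_eq0 => /orP[] /eqP; [left | right].
Qed.

Lemma golden_fr2 c : c ^+ 2 + c = 1 -> fr 2 c = c.
Proof.
move=> /golden_fr[] h; rewrite -(frD 1 1) h; first by [].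
by rewrite rmorphB rmorphN rmorph1 /= h; ring.
Qed.

Lemma fr2_fixed a : fr 2 a = a -> [/\ fr 3 a = fr 1 a, fr 4 a = a & fr 5 a = fr 1 a].
Proof.
by move=> a2; rewrite -(frD 3 2) -(frD 2 2) -(frD 1 2) a2 a2 -(frD 1 2) a2.
Qed.

Hypothesis dimL : \dim {:L} = 6%N.

Lemma fr_period i x : fr (6 + i) x = fr i x.
Proof. by rewrite -frD -dimL fr_dim. Qed.

Lemma fr6 x : fr 6 x = x.
Proof. by rewrite (fr_period 0) fr0. Qed.

Lemma fr_mod i x : fr (i %% 6) x = fr i x.
Proof.
rewrite [in RHS](divn_eq i 6); elim: (i %/ 6)%N => [|n IH] //.
by rewrite mulSn -addnA fr_period.
Qed.

(** Two exponents at most 5 add up to at most 10, so these periods bring every double Frobenius back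
    below 6. *)
Definition frE := (frD, fr6, fr_period 1, fr_period 2, fr_period 3, fr_period 4).

Lemma qpoly6_inj (a0 a1 a2 a3 a4 a5 : L) :
    (forall x, a0 * x + a1 * fr 1 x + a2 * fr 2 x + a3 * fr 3 x + a4 * fr 4 x
               + a5 * fr 5 x = 0) ->
  [/\ a0 = 0, a1 = 0 & a2 = 0] /\ [/\ a3 = 0, a4 = 0 & a5 = 0].
Proof.
move=> h; pose s := [:: a0; a1; a2; a3; a4; a5].
have sz i : (i < 6)%N -> s`_i = 0.
  move=> i6; have iL : (i < \dim {:L})%N by rewrite dimL.
  apply: (@qpoly_inj F L (fun i => s`_i) (fun _ => 0) _ (Ordinal iL)).
  apply/lfunP=> x; rewrite !qpolyE.
  rewrite [RHS]big1 => [|j _]; last by rewrite mul0r.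
  rewrite -(big_mkord xpredT (fun i => s`_i * x ^+ (#|F| ^ i))) dimL -[RHS](h x).
  by rewrite unlock /= /fr !expn0 !expr1 addr0 !addrA.
by split; split; [exact: (sz 0) | exact: (sz 1) | exact: (sz 2)
  | exact: (sz 3) | exact: (sz 4) | exact: (sz 5)].
Qed.

(** * Solutions of [f x = m x] in odd characteristic *)

Section Golden.

Variable c : L.
Hypotheses (hc : c ^+ 2 + c = 1) (two_nz : 2%:R != 0 :> L).

(** Applying [fr 1], [fr 3], [fr 5] to [f z = 0] gives three linear equations in [z], [z_2], [z_4].
    Their differences are [(d - 1) (z_2 - z) = 0] and [(d - 1) (z_4 - z) = 0], and then
    [(2 + d) z = 0]; both factors are nonzero. *)
Lemma trinom_inj z : trinom c z = 0 -> z = 0.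
Proof.
rewrite trinomE => e.
have hd : fr 1 c ^+ 2 + fr 1 c = 1 by rewrite -rmorphXn -rmorphD hc rmorph1.
have c2 := golden_fr2 hc.
have [c3 _ c5] := fr2_fixed c2.
have [d c1] : exists d, fr 1 c = d by exists (fr 1 c).
rewrite c1 in hd c3 c5.
have := congr1 (fr 1) e; have := congr1 (fr 3) e; have := congr1 (fr 5) e.
rewrite !(rmorphD, rmorphM, rmorph0) /= !frE c1 c3 c5 => e5 e3 e1.
have d1 : d - 1 != 0.
  apply: contraNneq (oner_neq0 L) => /eqP; rewrite subr_eq0 => /eqP d1.
  by move: hd; rewrite d1 expr1n => hd; apply/eqP/(addrI 1); rewrite addr0.
have d2 : 2%:R + d != 0.
  apply: contraNneq (oner_neq0 L) => /eqP; rewrite addrC addr_eq0 => /eqP d2.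
  by apply/eqP/esym; rewrite -[LHS](subrr 1) -{1}hd d2; ring.
have z2 : fr 2 z = z.
  apply/eqP; rewrite -subr_eq0; apply/eqP/(mulfI d1).
  by have := congr2 (fun a b => a - b) e3 e1; rewrite mulr0 subrr => <-; ring.
have z4 : fr 4 z = z.
  apply/eqP; rewrite -subr_eq0; apply/eqP/(mulfI d1).
  by have := congr2 (fun a b => a - b) e5 e1; rewrite mulr0 subrr => <-; ring.
by apply/(mulfI d2); move: e1; rewrite z2 z4 mulr0 => <-; ring.
Qed.

(* [fr 2] has order 3, and applying it three times multiplies [z] by [a ^ 3]. *)
Lemma fr2_eigen (a z : L) : fr 2 a = a -> z != 0 -> fr 2 z = a * z -> a ^+ 3 = 1.
Proof.
move=> fa z0 fz; apply: (mulIf z0); rewrite mul1r -[RHS]fr6.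
by rewrite -(frD 4 2) -(frD 2 2) fz !rmorphM /= fa fz rmorphM /= fa fz; ring.
Qed.

(** The conclusion says that [y / x] is fixed by the Frobenius; the product form also covers
    [x = 0]. *)
Lemma trinom_quotient m x y :
  trinom c x = m * x -> trinom c y = m * y -> x * fr 1 y = y * fr 1 x.
Proof.
have [-> | m0] := eqVneq m 0.
  by rewrite !mul0r => /trinom_inj-> /trinom_inj->; rewrite mul0r.
have [-> | x0] := eqVneq x 0; first by move=> _ _; rewrite rmorph0 mul0r mulr0.
move=> ex ey; set p := x * fr 2 y - y * fr 2 x.
have [p0 | p0] := eqVneq p 0.
  (* [p = 0] puts [t = y / x] in [F_(q^2)], so [f (t x) = t_1 f x], and [m x != 0] gives
     [t_1 = t]. *)
  have [t ty] : exists t, y = t * x by exists (y / x); rewrite divfK.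
  have t2 : fr 2 t = t.
    apply/eqP; rewrite -subr_eq0; apply/eqP.
    apply: (mulIf (_ : x * fr 2 x != 0)); first by rewrite mulf_neq0 ?fr_eq0.
    by rewrite mul0r -p0 /p ty rmorphM /=; ring.
  have [t3 _ t5] := fr2_fixed t2.
  have e : (fr 1 t - t) * (m * x) = 0.
    rewrite mulrBl -{1}ex mulrCA -ty -ey ty !trinomE !rmorphM /= t3 t5.
    by ring.
  have /eqP t1 : fr 1 t == t.
    by rewrite -subr_eq0; move/eqP: e; rewrite !mulf_eq0 (negPf m0) (negPf x0) !orbF.
  by rewrite ty rmorphM /= t1; ring.
have c2 := golden_fr2 hc.
have [c3 _ c5] := fr2_fixed c2.
have d2 : fr 2 (fr 1 c) = fr 1 c by rewrite frD c3.
have cd := golden_fr hc.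
have [d c1] : exists d, fr 1 c = d by exists (fr 1 c).
rewrite c1 in c3 c5 d2 cd.
pose k := m^-1; have k0 : k != 0 by rewrite invr_eq0.
pose A := fr 1 k + d * fr 3 k + c * fr 5 k.
pose E := fr 1 k + fr 3 k + c * d * fr 5 k.
(* Conjugates of [k f z = z] express [z_1], [z_3], [z_5] through [z], [z_2], [z_4]; substitute them
   into [f z]. *)
have rel z : trinom c z = m * z ->
    A * fr 2 z + E * fr 4 z = (m - (fr 1 k * d + fr 3 k + c * fr 5 k)) * z.
  move=> ez; have hz : k * trinom c z = z by rewrite ez /k mulKf.
  have := congr1 (fr 1) hz; have := congr1 (fr 3) hz; have := congr1 (fr 5) hz.
  rewrite !trinomE !(rmorphD, rmorphM) /= !frE c1 c3 c5 => h5 h3 h1.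
  by rewrite mulrBl -ez trinomE -h1 -h3 -h5 /A /E; ring.
(* Eliminate the right-hand side of [rel] between [x] and [y]. *)
have Ap : A * p = E * fr 4 p.
  have -> : fr 4 p = fr 4 x * y - fr 4 y * x by rewrite /p rmorphB !rmorphM /= !frE.
  apply/eqP; rewrite -subr_eq0; apply/eqP.
  have := congr2 (fun a b => a * x - b * y) (rel y ey) (rel x ex).
  by rewrite -[X in _ = X -> _]/(_ * y * x - _ * x * y) mulrAC subrr => <-; rewrite /p; ring.
have Ap2 := congr1 (fr 2) Ap; have Ap4 := congr1 (fr 4) Ap.
have k3 : fr 2 (fr 1 k) = fr 3 k by rewrite frE.
have k5 : fr 2 (fr 3 k) = fr 5 k by rewrite frE.
have k1 : fr 2 (fr 5 k) = fr 1 k by rewrite !frE.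
have d4 : fr 4 d = d by have [] := fr2_fixed d2.
have c4 : fr 4 c = c by have [] := fr2_fixed c2.
(* Multiply [Ap] by its two conjugates; the norm of [p] appears on both sides and cancels. *)
have prodAE : A * fr 2 A * fr 4 A = E * fr 2 E * fr 4 E.
  apply: (mulIf (_ : p * fr 2 p * fr 4 p != 0)); first by rewrite !mulf_neq0 ?fr_eq0.
  move: Ap2 Ap4; rewrite !rmorphM /= !frE => Ap2 Ap4.
  transitivity ((A * p) * (fr 2 A * fr 2 p) * (fr 4 A * fr 4 p)); first by ring.
  by rewrite Ap Ap2 Ap4; ring.
move: prodAE; rewrite /A /E !(rmorphD, rmorphM) /= !frE c2 d2 c4 d4.
have kz i : fr i k != 0 by rewrite fr_eq0.
(* A vanishing factor would make some [fr i k] an eigenvector of [fr 2] for [a]. *)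
have no_eigen a : fr 2 a = a -> a ^+ 3 != 1 ->
    (fr 3 k - a * fr 1 k) * (fr 5 k - a * fr 3 k) * (fr 1 k - a * fr 5 k) != 0.
  move=> fa; apply: contraNneq => /eqP; rewrite !mulf_eq0 !subr_eq0.
  case/orP=> [/orP[]|] /eqP e; apply/eqP.
  - by apply: (fr2_eigen fa (kz 1%N)); rewrite k3.
  - by apply: (fr2_eigen fa (kz 3)); rewrite k5.
  - by apply: (fr2_eigen fa (kz 5)); rewrite k1.
have c_sq : c ^+ 2 = 1 - c by rewrite -hc addrK.
move/eqP; rewrite -subr_eq0; case: cd => ->.
  rewrite prod_diff_fixed // mulf_eq0 => /orP[] /eqP e.
    (* [(6 c - 4) (3 c + 5) = - 2], so [6 c - 4] is nonzero. *)
    have /eqP : 2%:R = 0 :> L.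
      by transitivity (- (6%:R * c - 4%:R) * (3%:R * c + 5%:R));
        [ring: c_sq | rewrite e oppr0 mul0r].
    by rewrite (negPf two_nz).
  have : (- 1) ^+ 3 != 1 :> L.
    apply: contraNneq two_nz => e1; apply/eqP.
    by transitivity (1 - (- 1) ^+ 3 : L); [ring | rewrite e1 subrr].
  by move/(no_eigen _ (rmorphN1 _))/eqP=> []; rewrite -[RHS]e; ring.
rewrite prod_diff_moved // mulf_eq0 => /orP[] /eqP e.
  (* [c (1 + c) = 1] makes [1 + c] a unit. *)
  have /eqP : 1 = 0 :> L.
    by transitivity (- (- (1 + c) ^+ 3) * c ^+ 3); [ring: c_sq | rewrite e oppr0 mul0r].
  by rewrite oner_eq0.
(* [c^6 - 1 = 4 (1 - 2 c)], and [1 - 2 c] is a unit because [(1 - 2 c) (3 + 2 c) = - 1]. *)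
have : (c ^+ 2) ^+ 3 != 1.
  apply: contraNneq (oner_neq0 L) => e1; apply/eqP.
  have e2 : 4%:R * (1 - 2%:R * c) = 0.
    by transitivity ((c ^+ 2) ^+ 3 - 1); [ring: c_sq | rewrite e1 subrr].
  have e3 : 1 - 2%:R * c = 0.
    by apply/(mulfI two_nz)/(mulfI two_nz); rewrite mulrA -natrM e2 !mulr0.
  by transitivity (- (1 - 2%:R * c) * (3%:R + 2%:R * c));
    [ring: c_sq | rewrite e3 oppr0 mul0r].
by move/no_eigen; rewrite rmorphXn /= c2 e eqxx => /(_ erefl).
Qed.

End Golden.

End Frobenius.

(** * Cardinality and dimension of codes, and kernels of their elements *)

Section Codes.

Variables (F : finFieldType) (L : fieldExtType F).

Lemma lscaleE (a : L) f x : lscale a f x = a * f x.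
Proof. by rewrite comp_lfunE lfunE. Qed.

Lemma lscale_comp (a : L) f g : (lscale a f \o g)%VF = lscale a (f \o g)%VF.
Proof. by rewrite /lscale comp_lfunA. Qed.

Lemma card_finvect (vT : vectType F) : #|finvect_type vT| = (#|F| ^ \dim {:vT})%N.
Proof.
have <- := @card_vspace F (finvect_type vT) (Vector.class vT) fullv.
by apply: eq_card => v; rewrite (memvf (v : vT)).
Qed.

Lemma Lspan2_linear (f g : 'End(L)) : Fq_linear (Lspan2 f g).
Proof.
split=> [|k u v /Lspan2P[a [b ->]] /Lspan2P[a' [b' ->]]]; apply/Lspan2P.
  by exists 0, 0; apply/lfunP=> x; rewrite add_lfunE !lscaleE zero_lfunE !mul0r addr0.
exists (k *: a + a'), (k *: b + b'); apply/lfunP=> x.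
rewrite !(add_lfunE, lscaleE, scale_lfunE) scalerDr !mulrDl !scalerAl -!addrA.
by congr (_ + _); rewrite addrCA.
Qed.

Lemma Lspan2_lscale (f g h : 'End(L)) a :
  h \in Lspan2 f g -> lscale a h \in Lspan2 f g.
Proof.
case/Lspan2P=> b [b' ->]; apply/Lspan2P; exists (a * b), (a * b'); apply/lfunP=> x.
by rewrite !(add_lfunE, lscaleE) mulrDr !mulrA.
Qed.

Lemma card_Lspan2_le (f g : 'End(L)) : (#|Lspan2 f g| <= #|F| ^ (\dim {:L} * 2))%N.
Proof.
rewrite /Lspan2 curry_imset2X (leq_trans (leq_imset_card _ _)) //.
by rewrite cardsX !cardsT card_finvect -expnD addnn -muln2.
Qed.

Lemma card_Lspan2 (f g : 'End(L)) :
    (forall a b, lscale a f + lscale b g = 0 -> a = 0 /\ b = 0) ->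
  #|Lspan2 f g| = (#|F| ^ (\dim {:L} * 2))%N.
Proof.
move=> free; rewrite /Lspan2 curry_imset2X card_imset; last first.
  move=> [a b] [a' b'] /= e; suff [] : a - a' = 0 /\ b - b' = 0.
    by move=> /subr0_eq-> /subr0_eq->.
  apply: free; rewrite -[RHS](subrr (lscale a f + lscale b g : 'End(L))) {2}e.
  by apply/lfunP=> x; rewrite !(add_lfunE, opp_lfunE, lscaleE); ring.
by rewrite cardsX !cardsT card_finvect -expnD addnn -muln2.
Qed.

(** A linear code contains all combinations of its elements, so it equals its span. *)
Lemma code_dim_card (C : rdcode L) : Fq_linear C -> #|C| = (#|F| ^ code_dim C)%N.
Proof.
move=> [C0 CD].
have <- := @card_vspace F (finvect_type 'End(L)) (Vector.class 'End(L)) <<enum C>>%VS.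
apply: eq_card => v; apply/idP/idP => [vC | /(@coord_span _ _ _ (in_tuple _)) ->].
  by apply: memv_span; rewrite mem_enum.
apply: (big_ind (fun w : 'End(L) => w \in C)) => // [u w uC wC | i _].
  by have := CD 1 u w uC wC; rewrite scale1r.
have iC : (in_tuple (enum C))`_i \in C by rewrite -mem_enum mem_nth.
by have := CD (coord (in_tuple (enum C)) i v) _ _ iC C0; rewrite addr0.
Qed.

Lemma dim_ker_rank (f : 'End(L)) : (\dim (lker f) + Defs.rank f)%N = \dim {:L}.
Proof. by rewrite -[RHS](@limg_ker_dim F L L f fullv) capfv. Qed.

(** Quotients of kernel elements are fixed by the Frobenius, hence scalars, so one nonzero element
    spans the kernel. *)
Lemma dim_lker_le1 (f : 'End(L)) :
    (forall x y, f x = 0 -> f y = 0 -> x * fr 1 y = y * fr 1 x) ->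
  (\dim (lker f) <= 1)%N.
Proof.
move=> quot; pose v := vpick (lker f).
have fv : f v = 0 by apply/eqP; rewrite -memv_ker memv_pick.
(* [vpick] returns 0 only on the zero space. *)
have [v0 | v0] := eqVneq v 0.
  have /eqP-> : lker f == 0%VS by rewrite -vpick0; apply/eqP.
  by rewrite dimv0.
have -> : 1%N = \dim <[v]> by rewrite dim_vline v0.
apply/dimvS/subvP=> y; rewrite memv_ker => /eqP fy.
have [k hk] : exists k : F, y / v = k%:A.
  apply: fr1_mem; rewrite rmorphM fmorphV /=; apply/eqP.
  by rewrite eqr_div ?fr_eq0 // -(quot _ _ fv fy) mulrC.
by apply/vlineP; exists k; rewrite -[LHS](divfK v0) hk mulr_algl.
Qed.

End Codes.

(** * Parameters and idealisers of the trinomial code *)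

Section TrinomialCode.

Variables (F : finFieldType) (L : fieldExtType F).
Hypothesis dimL : \dim {:L} = 6%N.
Variable c : L.

Notation C := (Lspan2 \1%VF (trinom c)).

Lemma LspanE a b g x :
  (lscale a \1%VF + lscale b g : 'End(L)) x = a * x + b * g x.
Proof. by rewrite add_lfunE !lscaleE id_lfunE. Qed.

Lemma mem_Lspan2_id (g : 'End(L)) : \1%VF \in Lspan2 \1%VF g.
Proof.
apply/Lspan2P; exists 1, 0; apply/lfunP=> x.
by rewrite LspanE mul1r mul0r addr0 id_lfunE.
Qed.

Lemma mem_Lspan2_r (g : 'End(L)) : g \in Lspan2 \1%VF g.
Proof.
apply/Lspan2P; exists 0, 1; apply/lfunP=> x.
by rewrite LspanE mul1r mul0r add0r.
Qed.

Lemma trinom_free a b :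
  lscale a \1%VF + lscale b (trinom c) = 0 -> a = 0 /\ b = 0.
Proof.
move=> e; have [] // := qpoly6_inj dimL (a0 := a) (a1 := b) (a2 := 0) (a3 := b)
  (a4 := 0) (a5 := b * c).
  move=> x; have := congr1 (fun f : 'End(L) => f x) e.
  by rewrite LspanE trinomE zero_lfunE => e0; rewrite -[RHS]e0; ring.
by move=> [-> -> _] _.
Qed.

Lemma card_trinom : #|C| = (#|F| ^ 12)%N.
Proof. by rewrite (card_Lspan2 trinom_free) dimL. Qed.

Hypothesis hc : c ^+ 2 + c = 1.

Lemma trinom_trinom x :
  trinom c (trinom c x) = (1 + c + fr 1 c) * fr 2 x + (2%:R + c * fr 1 c) * fr 4 x
                          + (1 + c + fr 1 c) * x.
Proof.
have [c3 _ c5] := fr2_fixed (golden_fr2 hc).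
by rewrite !trinomE !(rmorphD, rmorphM) /= !frE // c3 c5; ring.
Qed.

(** Serves both the right idealiser and, with [b = k], the involution in characteristic 2. *)
Lemma trinom_lscale_trinom b x :
  trinom c (b * trinom c x) =
    (fr 1 b + fr 1 c * fr 3 b + c * fr 5 b) * fr 2 x
  + (fr 1 b + fr 3 b + c * fr 1 c * fr 5 b) * fr 4 x
  + (fr 1 c * fr 1 b + fr 3 b + c * fr 5 b) * x.
Proof.
have [c3 _ c5] := fr2_fixed (golden_fr2 hc).
by rewrite !trinomE !(rmorphD, rmorphM) /= !frE // c3 c5; ring.
Qed.

Hypothesis two_nz : 2%:R != 0 :> L.

Lemma dim_lker_code a b :
    lscale a \1%VF + lscale b (trinom c) != 0 ->
  (\dim (lker (lscale a \1%VF + lscale b (trinom c))%R) <= 1)%N.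
Proof.
move=> nz; apply: dim_lker_le1 => x y; rewrite !LspanE.
have [b0 | b0] := eqVneq b 0.
  have a0 : a != 0.
    apply: contraNneq nz => a0; rewrite a0 b0; apply/eqP/lfunP=> z.
    by rewrite LspanE zero_lfunE !mul0r addr0.
  rewrite b0 !mul0r !addr0 => /eqP; rewrite mulf_eq0 (negPf a0) => /eqP-> /eqP.
  by rewrite mulf_eq0 (negPf a0) => /eqP->; rewrite rmorph0 mulr0.
have solve z : a * z + b * trinom c z = 0 -> trinom c z = (- (a / b)) * z.
  by move=> /eqP; rewrite addrC addr_eq0 => /eqP e; apply/(mulfI b0); rewrite e; field.
by move=> /solve ex /solve ey; apply: (trinom_quotient dimL hc two_nz ex ey).
Qed.

Lemma trinom_min_dist : is_min_dist C 5.
Proof.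
have lb f g : f \in C -> g \in C -> f != g -> (5 <= rdist f g)%N.
  move=> /Lspan2P[a [b ->]] /Lspan2P[a' [b' ->]] fg.
  have := dim_ker_rank (lscale a \1%VF + lscale b (trinom c)
                       - (lscale a' \1%VF + lscale b' (trinom c)) : 'End(L)).
  rewrite dimL -/(rdist _ _) => e; rewrite -(leq_add2l 1) -[X in (X <= _)%N]/6%N -e leq_add2r.
  have -> : lscale a \1%VF + lscale b (trinom c)
      - (lscale a' \1%VF + lscale b' (trinom c))
      = lscale (a - a') \1%VF + lscale (b - b') (trinom c).
    by apply/lfunP=> x; rewrite add_lfunE opp_lfunE !LspanE; ring.
  apply: dim_lker_code; apply: contraNneq fg => /trinom_free[/subr0_eq-> /subr0_eq->].
  exact: eqxx.
(* This codeword vanishes at 1, so its rank is at most 5. *)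
split=> //; pose f : 'End(L) := lscale (- trinom c 1) \1%VF + lscale 1 (trinom c).
have C0 : 0 \in C by have [] := Lspan2_linear (\1%VF : 'End(L)) (trinom c).
have fC : f \in C by apply/Lspan2P; exists (- trinom c 1), 1.
have f0 : f != 0.
  by apply: contraNneq (oner_neq0 L) => /trinom_free[_ ->].
exists f, 0; split=> //; apply/eqP; rewrite eqn_leq lb // andbT /rdist subr0.
have := dim_ker_rank f; rewrite dimL => e.
rewrite -(leq_add2l 1) -[X in (_ <= X)%N]/6%N -e leq_add2r.
rewrite lt0n dimv_eq0; apply: contraNneq (oner_neq0 L) => k0; rewrite -memv0 -k0 memv_ker.
by rewrite LspanE mul1r mulr1 addNr.
Qed.

Lemma trinom_MRD : is_MRD C.
Proof. by exists 5%N; [exact: trinom_min_dist | rewrite card_trinom dimL]. Qed.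

Lemma code_dim_trinom : code_dim C = 12%N.
Proof.
apply/eqP; rewrite -(eqn_exp2l _ _ (finNzRing_gt1 F)) -card_trinom; apply/eqP/esym.
exact/code_dim_card/Lspan2_linear.
Qed.

Lemma golden_neq1 : c != 1.
Proof.
apply: contraNneq (oner_neq0 L) => c1; apply/eqP/(addrI 1).
by rewrite addr0 -[RHS]hc c1 expr1n.
Qed.

(** As the identity is in the code, [phi = a x + b f x]. If [b != 0], the coefficients of [x_2] and
    [x_4] in [phi (f x)] force [1 + c + d = 0] and [2 + c d = 0], but the former turns [2 + c d]
    into 1. *)
Lemma mem_left_idealiser phi :
  phi \in left_idealiser C <-> exists a, phi = lscale a \1%VF.
Proof.
rewrite inE; split=> [/forall_inP phiC | [a ->]]; last first.
  apply/forall_inP=> f fC; rewrite (_ : (_ \o _)%VF = lscale a f) ?Lspan2_lscale //.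
  by rewrite lscale_comp comp_lfun1l.
have c_sq : c ^+ 2 = 1 - c by rewrite -hc addrK.
have := phiC _ (mem_Lspan2_id _); rewrite comp_lfun1r => /Lspan2P[a [b ephi]].
exists a; suff b0 : b = 0.
  by rewrite ephi b0; apply/lfunP=> x; rewrite LspanE mul0r addr0 lscaleE id_lfunE.
have /Lspan2P[a' [b' e]] := phiC _ (mem_Lspan2_r _).
have [] := qpoly6_inj dimL (a0 := b * (1 + c + fr 1 c) - a') (a1 := a - b')
   (a2 := b * (1 + c + fr 1 c)) (a3 := a - b') (a4 := b * (2%:R + c * fr 1 c))
   (a5 := (a - b') * c).
  move=> x; have := congr1 (fun f : 'End(L) => f x) e.
  rewrite comp_lfunE ephi !LspanE trinom_trinom => /eqP; rewrite -subr_eq0 => /eqP <-.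
  by rewrite trinomE; ring.
move=> [_ _ e2] [_ e4 _]; apply/eqP; apply: contraT => b0.
move/eqP: e2; rewrite mulf_eq0 (negPf b0) => /= /eqP e2.
move/eqP: e4; rewrite mulf_eq0 (negPf b0) => /= /eqP e4.
have cN : fr 1 c = - 1 - c by rewrite -[RHS]add0r -{1}e2; ring.
have /eqP : 1 = 0 :> L by rewrite -[RHS]e4 cN; ring: c_sq.
by rewrite oner_eq0.
Qed.

(** Again [phi = a x + b f x]. In [f (phi x)] the odd exponents give [a_1 = a_3], so [a] is in
    [F_(q^2)]; those of [x_2] and [x_4] give [b = 0]. *)
Lemma mem_right_idealiser phi :
  phi \in right_idealiser C <-> exists2 a, fr 2 a = a & phi = lscale a \1%VF.
Proof.
rewrite inE; split=> [/forall_inP phiC | [a a2 ->]]; last first.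
  apply/forall_inP=> _ /Lspan2P[b [b' ->]]; apply/Lspan2P.
  exists (b * a), (b' * fr 1 a); apply/lfunP=> x.
  have [a3 _ a5] := fr2_fixed a2.
  rewrite comp_lfunE !LspanE lscaleE id_lfunE !trinomE !rmorphM /= a3 a5.
  by ring.
have c_sq : c ^+ 2 = 1 - c by rewrite -hc addrK.
have := phiC _ (mem_Lspan2_id _); rewrite comp_lfun1l => /Lspan2P[a [b ephi]].
have /Lspan2P[a' [b' e]] := phiC _ (mem_Lspan2_r _).
have [] := qpoly6_inj dimL
   (a0 := fr 1 c * fr 1 b + fr 3 b + c * fr 5 b - a') (a1 := fr 1 a - b')
   (a2 := fr 1 b + fr 1 c * fr 3 b + c * fr 5 b) (a3 := fr 3 a - b')
   (a4 := fr 1 b + fr 3 b + c * fr 1 c * fr 5 b) (a5 := c * (fr 5 a - b')).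
  move=> x; have := congr1 (fun f : 'End(L) => f x) e.
  rewrite comp_lfunE ephi !LspanE linearD /= trinom_lscale_trinom.
  rewrite !(trinomE c (a * x)) !rmorphM /= => /eqP; rewrite -subr_eq0 => /eqP <-.
  by rewrite trinomE; ring.
move=> [_ a1 e2] [a3 e4 _].
have a_fix : fr 2 a = a.
  apply: (fmorph_inj (fr 1)); rewrite /= frD.
  by rewrite (subr0_eq a1) (subr0_eq a3).
exists a => //; suff b0 : b = 0.
  by rewrite ephi b0; apply/lfunP=> x; rewrite LspanE mul0r addr0 lscaleE id_lfunE.
have b3_0 : fr 3 b = 0 -> b = 0 by move/eqP; rewrite fr_eq0 => /eqP.
have b2 : fr 2 (fr 1 b) = fr 3 b by rewrite frD.
have b4 : fr 2 (fr 3 b) = fr 5 b by rewrite frD.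
have b6 : fr 2 (fr 5 b) = fr 1 b by rewrite !frE.
have [dc | dc] := golden_fr hc; rewrite dc in e2 e4; last first.
  (* Here [c d = - 1]; adding this equation to its image under [fr 2] leaves [2 b_3 = 0]. *)
  have e4' : fr 1 b + fr 3 b - fr 5 b = 0 by rewrite -[RHS]e4; ring: c_sq.
  have := congr1 (fr 2) e4'; rewrite rmorphB rmorphD rmorph0 /= b2 b4 b6 => e4''.
  apply/b3_0/(mulfI two_nz); rewrite mulr0 -[RHS](addr0 0) -{1}e4' -e4''.
  by ring.
(* Since [c (c + 1) = 1], this makes [b_3] an eigenvector of [fr 2] for [c + 1] unless [b = 0]. Then
   [c^3 = 1], while [c^3 - 1 = 2 (c - 1)]. *)
have b3c : fr 3 b = c * fr 5 b.
  have c1 : c - 1 != 0 by rewrite subr_eq0 golden_neq1.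
  by apply/(mulfI c1)/eqP; rewrite -subr_eq0 -(subrr 0) -{1}e2 -e4; apply/eqP; ring.
have b5c : fr 5 b = (c + 1) * fr 3 b by rewrite b3c; ring: c_sq.
apply/eqP; apply: contraT => b0; have := golden_neq1.
have: (c + 1) ^+ 3 = 1.
  apply: (fr2_eigen dimL (z := fr 3 b)); rewrite ?fr_eq0 ?b4 //.
  by rewrite rmorphD rmorph1 /= golden_fr2.
move=> e3; suff -> : c = 1 by rewrite eqxx.
have c3 : c ^+ 3 = 1.
  by transitivity (c ^+ 3 * (c + 1) ^+ 3); [rewrite e3 mulr1 | ring: c_sq].
apply/(mulfI two_nz)/eqP; rewrite -subr_eq0; apply/eqP.
by transitivity (c ^+ 3 - 1); [ring: c_sq | rewrite c3 subrr].
Qed.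

Lemma left_idealiser_iso : alg_isomorphic (left_idealiser C) L.
Proof.
exists (@amull F L : {linear L -> 'End(L)}); split.
- by move=> x y /(congr1 (fun f : 'End(L) => f 1)); rewrite !lfunE /= !mulr1.
- by apply/lfunP=> x; rewrite lfunE id_lfunE /= mul1r.
- by move=> x y; apply/lfunP=> z; rewrite comp_lfunE !lfunE /= mulrA.
move=> phi; rewrite mem_left_idealiser /lscale.
by split=> -[x e]; exists x; move: e; rewrite comp_lfun1r.
Qed.

Lemma right_idealiser_iso (K : {subfield L}) :
  \dim K = 2%N -> alg_isomorphic (right_idealiser C) (subvs_of K).
Proof.
move=> dimK; exists ((@amull F L) \o vsval : {linear subvs_of K -> 'End(L)}); split.
- move=> x y /(congr1 (fun f : 'End(L) => f 1)) /=.
  by rewrite !lfunE /= !mulr1 => /val_inj.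
- by apply/lfunP=> x; rewrite /= lfunE id_lfunE /= algid1 mul1r.
- by move=> x y; apply/lfunP=> z; rewrite comp_lfunE !lfunE /= mulrA.
have memK x : (x \in K) = (fr 2 x == x) by rewrite Fermat's_little_theorem dimK.
move=> phi; rewrite mem_right_idealiser /lscale.
split=> [[a fa ->] | [x <-]]; last first.
  exists (vsval x); first by apply/eqP; rewrite -memK subvsP.
  by rewrite comp_lfun1r.
have aK : a \in K by rewrite memK fa.
by exists (Subvs aK); rewrite comp_lfun1r.
Qed.

End TrinomialCode.

(** * Failure of minimum distance 5 in characteristic 2 *)

Section EvenCharacteristic.

Variables (F : finFieldType) (L : fieldExtType F).

(** The multiplicative group is cyclic of order [u v]: if [z = w^i] for a generator [w], then [u v]
    divides [i v], so [u] divides [i]. *)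
Lemma exists_root (u v : nat) (z : L) :
  (u * v)%N = (#|F| ^ \dim {:L}).-1 -> z ^+ v = 1 -> exists k : L, k ^+ u = z.
Proof.
move=> uv zv; have Q_gt1 : (1 < #|F| ^ \dim {:L})%N.
  by rewrite -{1}(expn0 #|F|) ltn_exp2l ?finNzRing_gt1 // adim_gt0.
have Q_n : (#|F| ^ \dim {:L} = (#|F| ^ \dim {:L}).-1.+1)%N by rewrite prednK // ltnW.
move: (_.-1) uv Q_n Q_gt1 => n uv Q_n; rewrite Q_n ltnS => n_gt0.
have /hasP[w _ w_prim] : has n.-primitive_root (enum (predC1 (0 : finvect_type L))).
  apply: has_prim_root; rewrite ?enum_uniq //; last first.
    by rewrite -cardE cardC1 card_finvect Q_n.
  apply/allP=> x; rewrite mem_enum => /= x0; apply/unity_rootP/(mulfI x0).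
  by rewrite mulr1 -exprS -Q_n; apply: fr_dim.
have zn : z ^+ n = 1 by rewrite -uv mulnC exprM zv expr1n.
have [i ez] := prim_rootP w_prim zn.
have v_gt0 : (0 < v)%N by move: n_gt0; rewrite -uv muln_gt0 => /andP[].
have /dvdnP[j ij] : (u %| i)%N.
  rewrite -(dvdn_pmul2r v_gt0) uv (prim_order_dvd w_prim) exprM.
  by rewrite -ez zv.
by exists (w ^+ j); rewrite -exprM -ij ez.
Qed.

Hypothesis dimL : \dim {:L} = 6%N.
Hypothesis two_z : 2%:R = 0 :> L.
Variable c : L.
Hypothesis hc : c ^+ 2 + c = 1.

Notation C := (Lspan2 \1%VF (trinom c)).

Let addxx (x : L) : x + x = 0.
Proof. by rewrite -mulr2n -mulr_natl two_z mul0r. Qed.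

Let oppL (x : L) : - x = x.
Proof. by apply/esym/eqP; rewrite -addr_eq0 addxx. Qed.

Let c_sq : c ^+ 2 = 1 + c. Proof. by rewrite -hc -[X in _ + _ + X]oppL addrK. Qed.

Let c_cube : c ^+ 3 = 1.
Proof. by transitivity (1 + 2%:R * c); [ring: c_sq | rewrite two_z mul0r addr0]. Qed.

Lemma not_min_dist a b :
    lscale a \1%VF + lscale b (trinom c) != 0 ->
    (1 < \dim (lker (lscale a \1%VF + lscale b (trinom c))%R))%N ->
  ~ is_min_dist C 5.
Proof.
set f := (_ + _) => f0 kerf [_ lb].
have C0 : 0 \in C by have [] := Lspan2_linear (\1%VF : 'End(L)) (trinom c).
have fC : f \in C by apply/Lspan2P; exists a, b.
have := lb f 0 fC C0 f0; rewrite /rdist subr0 => rk.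
by have := leq_add kerf rk; rewrite dim_ker_rank dimL.
Qed.

Lemma not_min_dist_fixed : fr 1 c = c -> ~ is_min_dist C 5.
Proof.
move=> c1; set q := #|F|; have q_gt1 : (1 < q)%N := finNzRing_gt1 F.
have cq i : c ^+ (q ^ i) = c.
  elim: i => [|i IH]; first by rewrite expn0 expr1.
  by rewrite expnSr exprM IH; move: c1; rewrite /fr expn1.
(* The norm of [c] to [F_q] is [c^6 = 1]. *)
have [y yc] : exists y : L, y ^+ q.-1 = c.
  apply: (@exists_root _ (\sum_(i < 6) q ^ i)); first by rewrite dimL -predn_exp.
  rewrite expr_sum (eq_bigr (fun=> c)) => [|i _]; last exact: cq.
  by rewrite prodr_const card_ord (exprM c 3 2) c_cube expr1n.
have y0 : y != 0.
  apply: contraNneq (oner_neq0 L) => y0; move: yc; rewrite y0 expr0n.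
  rewrite (negPf (_ : q.-1 != 0)%N) => [c0|]; last by rewrite -lt0n -ltnS prednK // ltnW.
  by apply/eqP; rewrite -[LHS]c_cube -c0 expr0n.
have y1 : fr 1 y = c * y by rewrite /fr expn1 -yc -exprSr prednK // ltnW.
have y2 : fr 2 y = c ^+ 2 * y by rewrite -(frD 1 1) y1 rmorphM /= c1 y1; ring.
have y3 : fr 3 y = y.
  by rewrite -(frD 1 2) y2 rmorphM rmorphXn /= c1 y1 mulrA -exprSr c_cube mul1r.
have y5 : fr 5 y = c ^+ 2 * y by rewrite -(frD 2 3) y3 y2.
apply: (@not_min_dist (- c) 1).
  apply: contraNneq (oner_neq0 L) => /(trinom_free dimL)[_ ->]; exact: eqxx.
(* A kernel of dimension 1 would be the line of 1, so [y] would be in [F_q], against [y_1 = c y]. *)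
rewrite ltnNge; apply/negP=> ker1; have c_neq1 := golden_neq1 hc.
have /vlineP[k ek] : y \in <[1 : L]>%VS.
  suff <- : (lker (lscale (- c) \1%VF + lscale 1 (trinom c))%R) = <[1]>%VS.
    rewrite memv_ker LspanE trinomE y1 y3 y5.
    apply/eqP; transitivity (y * (1 + c ^+ 3)); first by ring.
    by rewrite c_cube -mulr2n -[1 *+ 2]/2%:R two_z mulr0.
  apply/esym/eqP; rewrite eqEdim dim_vline oner_neq0 ker1 andbT -memvE memv_ker.
  rewrite LspanE trinomE !rmorph1; apply/eqP.
  by transitivity (2%:R : L); [ring | rewrite two_z].
move: y1; rewrite /fr expn1 ek exprZn expf_card expr1n -mulr_algl mulr1 => /eqP.
rewrite -{1}[_%:A]mul1r -subr_eq0 -mulrBl mulf_eq0 subr_eq0 eq_sym (negPf c_neq1).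
by rewrite -ek (negPf y0).
Qed.

Lemma not_min_dist_moved : fr 1 c = - 1 - c -> ~ is_min_dist C 5.
Proof.
rewrite 2!oppL -c_sq => c1; set q := #|F|.
have q_gt1 : (1 < q)%N := finNzRing_gt1 F.
have c2 : c ^+ (q ^ 2) = c := golden_fr2 hc.
(* The norm of [c] to [F_(q^2)] is [c^3 = 1], and the exponents multiply to [q^6 - 1]. *)
have [k kc] : exists k : L, k ^+ q.+1 = c.
  apply: (@exists_root _ (q.-1 * (1 + q ^ 2 + q ^ 4))%N).
    rewrite dimL -/q -(prednK (ltnW q_gt1)); move: q.-1 => r.
    by apply: (@addIn 1); rewrite [RHS]addn1 prednK ?expn_gt0 // succnK; ring.
  rewrite mulnC exprM !exprD expr1 c2 (_ : 4 = 2 + 2)%N // expnD exprM !c2.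
  by rewrite -expr2 -exprSr c_cube expr1n.
have k0 : k != 0.
  apply: contraNneq (oner_neq0 L) => k0; move: kc; rewrite k0 expr0n /= => c0.
  by apply/eqP; rewrite -[LHS]c_cube -c0 expr0n.
have k1 : fr 1 k = c / k.
  by apply/(mulfI k0); rewrite /fr expn1 -exprS kc mulrC divfK.
have c0 : c != 0.
  apply: contraNneq (oner_neq0 L) => c0; apply/eqP.
  by rewrite -[LHS]c_cube c0 expr0n.
have k2 : fr 2 k = c * k.
  by rewrite -(frD 1 1) k1 rmorphM fmorphV /= c1 k1; field; rewrite c0 k0.
have k3 : fr 3 k = k^-1.
  by rewrite -(frD 1 2) k2 rmorphM /= c1 k1 mulrA -exprSr c_cube mul1r.
have [c3 _ _] := fr2_fixed (golden_fr2 hc).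
have k5 : fr 5 k = c ^+ 2 / k by rewrite -(frD 3 2) k2 rmorphM /= c3 c1 k3.
pose th : 'End(L) := lscale 1 \1%VF + lscale k (trinom c).
have th0 : th != 0.
  by apply: contraNneq (oner_neq0 L) => /(trinom_free dimL)[->].
(* The coefficients of [x_2] and [x_4] are multiples of [1 + c + c^2 = 0]. *)
have inv x : k * trinom c (k * trinom c x) = x.
  rewrite trinom_lscale_trinom // c1 k1 k3 k5.
  have s0 : c + c ^+ 2 + 1 = 0 by rewrite addrC addrA -c_sq addxx.
  have kK : k * k^-1 = 1 by rewrite mulfV.
  transitivity ((k * k^-1) * ((c + c ^+ 2 + c ^+ 3) * fr 2 x
      + (c + 1 + c ^+ 3 * c ^+ 2) * fr 4 x + (c ^+ 3 + 1 + c ^+ 3) * x)); first by ring.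
  by rewrite kK c_cube !mul1r [c + 1 + _]addrAC s0 addxx !mul0r !add0r mul1r.
(* [(1 + k f)^2 = 1 + (k f)^2 = 0] in characteristic 2. *)
have sub : (limg th <= lker th)%VS.
  apply/subvP=> _ /memv_imgP[x _ ->]; rewrite memv_ker !LspanE !mul1r linearD /=.
  rewrite mulrDr inv; apply/eqP.
  by rewrite [X in _ + X]addrC -[X in _ + X]oppL subrr.
apply: (not_min_dist th0); have := dim_ker_rank th.
rewrite dimL => e; have := dimvS sub; rewrite -(leq_add2l (\dim (lker th))) e.
by case: (\dim (lker th)) => [|[]].
Qed.

End EvenCharacteristic.

(** * Inequivalence with the known codes *)

Section Equivalence.

Variables (F : finFieldType) (L : fieldExtType F).

(** Write [chi] as a q-polynomial with coefficients [a_i]. Comparing coefficients in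
    [chi (y x) = chi y * chi x] gives [a_i y_i = a_i chi y], and some [a_i] is nonzero. *)
Lemma multiplicative_fr (chi : 'End(L)) :
    chi 1 = 1 -> (forall x y, chi (x * y) = chi x * chi y) ->
  exists2 i, (i < \dim {:L})%N & chi =1 fr i.
Proof.
move=> chi1 chiM; have [a ea] := qpoly_surj chi.
have fixed i y : a i * (fr i y - chi y) = 0.
  apply/eqP; rewrite mulrBr subr_eq0 [a i * chi y]mulrC; apply/eqP.
  apply: (@qpoly_inj F L (fun i => a i * fr i y) (fun i => chi y * a i)).
  apply/lfunP=> x; transitivity (chi (y * x)).
    rewrite ea !qpolyE; apply: eq_bigr => j _.
    by rewrite -mulrA -[_ * x ^+ _]/(fr j y * fr j x) -rmorphM.
  rewrite chiM [in chi x]ea !qpolyE mulr_sumr; apply: eq_bigr => j _.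
  by rewrite mulrA.
have [i ai] : exists i, a i != 0.
  apply/existsP; apply: contraNT (oner_neq0 L); rewrite negb_exists => /forallP a0.
  rewrite -chi1 ea qpolyE big1 // => i _.
  by have := a0 i; rewrite negbK => /eqP->; rewrite mul0r.
exists i => // y; apply/esym/subr0_eq/(mulfI ai).
by rewrite fixed mulr0.
Qed.

Hypothesis dimL : \dim {:L} = 6%N.

(** The map [h] allows both twisted coefficients, with [h = rho], and plain ones, with [h = id]. *)
Lemma qpoly6E (h : L -> L) (s : seq L) (x : L) :
  Defs.qpoly (fun i : 'I_(\dim {:L}) => h s`_i) x =
    h s`_0 * x + h s`_1 * fr 1 x + h s`_2 * fr 2 x + h s`_3 * fr 3 x + h s`_4 * fr 4 x
    + h s`_5 * fr 5 x.
Proof.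
rewrite qpolyE -(big_mkord xpredT (fun i => h s`_i * x ^+ (#|F| ^ i))) dimL.
by rewrite unlock /= /fr !expn0 !expr1 addr0 !addrA.
Qed.

(** Pulling coefficients back along [rho] shows that every codeword for [rho c] is the twist of one
    for [c]. *)
Lemma twist_mem c (rho : {rmorphism L -> L}) (phi1 phi2 : 'End(L)) (D : rdcode L) :
    bijective rho ->
    (forall a : 'I_(\dim {:L}) -> L, Defs.qpoly a \in Lspan2 \1%VF (trinom c) ->
       (phi1 \o Defs.qpoly (rho \o a) \o phi2)%VF \in D) ->
  forall f, f \in Lspan2 \1%VF (trinom (rho c)) -> (phi1 \o f \o phi2)%VF \in D.
Proof.
move=> [rhoV rhoK rhoVK] CD f /Lspan2P[a [b ->]].
pose s := [:: rhoV a; rhoV b; 0; rhoV b; 0; rhoV b * c].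
have := CD (fun i => s`_i); set g := Defs.qpoly (rho \o _).
have -> : g = lscale a \1%VF + lscale b (trinom (rho c)).
  apply/lfunP=> x; rewrite LspanE trinomE [LHS](qpoly6E rho) /= rmorph0 rmorphM /= !rhoVK.
  by ring.
apply; apply/Lspan2P; exists (rhoV a), (rhoV b); apply/lfunP=> x.
by rewrite LspanE trinomE (qpoly6E id) /=; ring.
Qed.

Variable c : L.
Hypotheses (hc : c ^+ 2 + c = 1) (two_nz : 2%:R != 0 :> L).

(* Comparing left idealisers forces [phi1] to be a monomial, which can be absorbed
   in the twist and in [phi2]. *)
Lemma equivalent_trinom (g : 'End(L)) :
    equivalent (Lspan2 \1%VF (trinom c)) (Lspan2 \1%VF g) ->
  exists (d : L) (phi : 'End(L)),
    [/\ d ^+ 2 + d = 1, phi != 0, phi \in Lspan2 \1%VF g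
      & (trinom d \o phi)%VF \in Lspan2 \1%VF g].
Proof.
move=> [phi1 [phi2 [rho [bij1 bij2 bijr /(twist_mem bijr) CD]]]].
set D := Lspan2 _ g in CD *; set c' := rho c in CD; set C' := Lspan2 _ _ in CD.
have hc' : c' ^+ 2 + c' = 1 by rewrite -rmorphXn -rmorphD hc rmorph1.
have k1 : lker phi1 == 0%VS by apply/lker0P/bij_inj.
have k2 : lker phi2 == 0%VS by apply/lker0P/bij_inj.
pose conj (f : finvect_type 'End(L)) : finvect_type 'End(L) := (phi1 \o f \o phi2)%VF.
have conj_inj : injective conj.
  move=> f f' /lfunP e; apply/lfunP=> x; apply: (bij_inj bij1).
  by have := e (phi2^-1%VF x); rewrite /conj !comp_lfunE lker0_lfunVK.
(* [D] has at most [q^12] elements, so the injection is onto. *)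
have imD : conj @: C' = D.
  have D_le := card_Lspan2_le \1%VF g; rewrite dimL in D_le.
  apply/eqP; rewrite eqEcard card_imset // card_trinom // D_le andbT.
  by apply/subsetP=> _ /imsetP[f fC ->]; apply: CD.
(* [D] is closed under multiplication by [b], so conjugating by [phi1] gives an element of the left
   idealiser of [C'], which is a scalar. *)
have conjL b : exists a, forall x, phi1^-1%VF (b * phi1 x) = a * x.
  pose psi : finvect_type 'End(L) := (phi1^-1 \o lscale b phi1)%VF.
  have /(mem_left_idealiser dimL hc')[a ea] : psi \in left_idealiser C'.
    rewrite inE; apply/forall_inP=> f fC.
    have : lscale b (conj f) \in D by apply: Lspan2_lscale; apply: CD.
    rewrite -imD => /imsetP[f' f'C e]; suff -> : (psi \o f)%VF = f' by [].
    apply/lfunP=> x; rewrite comp_lfunE [psi _]comp_lfunE lscaleE.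
    have := congr1 (fun h : 'End(L) => h (phi2^-1%VF x)) e.
    by rewrite lscaleE /conj !comp_lfunE lker0_lfunVK // => ->; rewrite lker0_lfunK.
  exists a => x; have := congr1 (fun h : 'End(L) => h x) ea.
  by rewrite comp_lfunE !lscaleE id_lfunE.
pose w := phi1 1; have w0 : w != 0.
  by apply: contraNneq (oner_neq0 L) => w0; apply/eqP/(bij_inj bij1); rewrite linear0.
(* The inverse of [phi1], normalised to fix 1; [conjL] makes it multiplicative, hence a Frobenius
   power. *)
pose chi : 'End(L) := (phi1^-1 \o amull w)%VF.
have chiE b : chi b = phi1^-1%VF (b * w) by rewrite comp_lfunE lfunE /= mulrC.
have chi1 : chi 1 = 1 by rewrite chiE mul1r lker0_lfunK.
have chiM x y : chi (x * y) = chi x * chi y.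
  have [a ea] := conjL x; rewrite !chiE.
  have -> : phi1^-1%VF (x * w) = a by rewrite ea mulr1.
  by rewrite -ea lker0_lfunVK // mulrA.
have [j jL echi] := multiplicative_fr chi1 chiM.
have phi1E z : phi1 z = w * fr (6 - j) z.
  have ez : fr j (fr (6 - j) z) = z.
    by rewrite frD subnK ?(fr6 dimL) // ltnW // -dimL.
  by rewrite -{1}ez -echi chiE lker0_lfunVK // mulrC.
pose phi : 'End(L) := lscale w^-1 (phi1 \o phi2)%VF.
have phiE x : phi x = fr (6 - j) (phi2 x) by rewrite lscaleE comp_lfunE phi1E mulKf.
exists (fr (6 - j) c'), phi; split.
- by rewrite -rmorphXn -rmorphD hc' rmorph1.
- apply: contraNneq (oner_neq0 L) => phi0; apply/eqP/(bij_inj bij2).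
  rewrite linear0; apply/eqP; rewrite -(fr_eq0 (6 - j)) -phiE phi0 lfunE; exact: eqxx.
- apply: Lspan2_lscale; have -> : phi1 = (phi1 \o \1)%VF by rewrite comp_lfun1r.
  exact/CD/mem_Lspan2_id.
(* Moving [fr (6 - j)] across the trinomial only conjugates [c']. *)
have -> : (trinom (fr (6 - j) c') \o phi)%VF = lscale w^-1 (phi1 \o trinom c' \o phi2)%VF.
  apply/lfunP=> x; transitivity (trinom (fr (6 - j) c') (phi x)).
    by rewrite comp_lfunE.
  rewrite phiE lscaleE 2!comp_lfunE phi1E mulKf // !trinomE.
  rewrite !(rmorphD, rmorphM) /= !frD.
  by rewrite !(addnC (6 - j)%N).
exact/Lspan2_lscale/CD/mem_Lspan2_r.
Qed.


Lemma golden_sub1_neq0 (d : L) : d ^+ 2 + d = 1 -> d - 1 != 0.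
Proof. by move=> hd; rewrite subr_eq0 golden_neq1. Qed.

(** The [x_3] term gives [al = 0]. The [x_4] relation minus the conjugated [x_2] relation is
    [(d - 1) E_5 = 0]. *)
Lemma trinom_comp15 (d al be u v a b : L) :
    d ^+ 2 + d = 1 ->
    (forall x, trinom d (al * x + be * (u * fr 1 x + v * fr 5 x))
               = a * x + b * (u * fr 1 x + v * fr 5 x)) ->
  [/\ al = 0, be * u = 0 & be * v = 0].
Proof.
move=> hd e; set B := be * u; set E := be * v.
have [] := qpoly6_inj dimL (a0 := fr 1 E + d * fr 5 B - a) (a1 := fr 1 al - b * u)
  (a2 := fr 1 B + fr 3 E) (a3 := fr 3 al) (a4 := fr 3 B + d * fr 5 E)
  (a5 := d * fr 5 al - b * v).
  move=> x; have /eqP := e x; rewrite -subr_eq0 => /eqP <-.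
  by rewrite trinomE !(rmorphD, rmorphM) /= !frE // /B /E ?rmorphM /=; ring.
move=> [_ _ e2] [/eqP e3 e4 _]; move: e3; rewrite fr_eq0 => /eqP al0.
have := congr1 (fr 2) e2; rewrite rmorphD rmorph0 /= !frD => e2'.
have E0 : E = 0.
  apply/eqP; rewrite -(fr_eq0 5); apply/eqP/(mulfI (golden_sub1_neq0 hd)).
  by rewrite mulr0 -[RHS](subrr 0) -{1}e4 -e2'; ring.
have B0 : B = 0.
  by move/eqP: e4; rewrite E0 rmorph0 mulr0 addr0 fr_eq0 => /eqP.
by split.
Qed.

(** The [x_2] term gives [B = 0]. Eliminating [al] between the [x_3] and [x_5] relations leaves
    [(1 - d^2) E_1 = 0], where [1 - d^2 = d]. *)
Lemma trinom_comp14 (d al be u v a b : L) :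
    d ^+ 2 + d = 1 ->
    (forall x, trinom d (al * x + be * (u * fr 1 x + v * fr 4 x))
               = a * x + b * (u * fr 1 x + v * fr 4 x)) ->
  [/\ al = 0, be * u = 0 & be * v = 0].
Proof.
move=> hd e; set B := be * u; set E := be * v.
have d_sq : d ^+ 2 = 1 - d by rewrite -hd addrK.
have [] := qpoly6_inj dimL (a0 := d * fr 5 B - a) (a1 := fr 1 al + fr 3 E - b * u)
  (a2 := fr 1 B) (a3 := fr 3 al + d * fr 5 E) (a4 := fr 3 B - b * v)
  (a5 := fr 1 E + d * fr 5 al).
  move=> x; have /eqP := e x; rewrite -subr_eq0 => /eqP <-.
  by rewrite trinomE !(rmorphD, rmorphM) /= !frE // /B /E ?rmorphM /=; ring.
move=> [_ _ /eqP e2] [e3 _ e5]; move: e2; rewrite fr_eq0 => /eqP B0.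
have := congr1 (fr 2) e3; rewrite rmorphD rmorphM rmorph0 /= (golden_fr2 hd) !frE // => e3'.
have d0 : d != 0.
  by apply: contraNneq (oner_neq0 L) => d0; rewrite -hd d0 expr0n addr0.
have E0 : E = 0.
  apply/eqP; rewrite -(fr_eq0 1); apply/eqP/(mulfI d0).
  by transitivity (fr 1 E + d * fr 5 al - d * (fr 5 al + d * fr 1 E));
    [ring: d_sq | rewrite e3' e5 mulr0 subrr].
have al0 : al = 0.
  by move/eqP: e3; rewrite E0 rmorph0 mulr0 addr0 fr_eq0 => /eqP.
by split.
Qed.

(** The [x_4] term gives [E = 0]. The [x_1] relation minus the conjugated [x_3] relation is
    [(d - 1) B_5 = 0]. *)
Lemma trinom_comp25 (d al be u v a b : L) :
    d ^+ 2 + d = 1 ->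
    (forall x, trinom d (al * x + be * (u * fr 2 x + v * fr 5 x))
               = a * x + b * (u * fr 2 x + v * fr 5 x)) ->
  [/\ al = 0, be * u = 0 & be * v = 0].
Proof.
move=> hd e; set B := be * u; set E := be * v.
have d0 : d != 0.
  by apply: contraNneq (oner_neq0 L) => d0; rewrite -hd d0 expr0n addr0.
have [] := qpoly6_inj dimL (a0 := fr 1 E - a) (a1 := fr 1 al + d * fr 5 B)
  (a2 := fr 3 E - b * u) (a3 := fr 3 al + fr 1 B) (a4 := d * fr 5 E)
  (a5 := d * fr 5 al + fr 3 B - b * v).
  move=> x; have /eqP := e x; rewrite -subr_eq0 => /eqP <-.
  by rewrite trinomE !(rmorphD, rmorphM) /= !frE // /B /E ?rmorphM /=; ring.
move=> [_ e1 _] [e3 /eqP e4 _]; move: e4.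
rewrite mulf_eq0 (negPf d0) fr_eq0 => /eqP E0.
have := congr1 (fr 4) e3; rewrite rmorphD rmorph0 /= !frE // => e3'.
have B0 : B = 0.
  apply/eqP; rewrite -(fr_eq0 5); apply/eqP/(mulfI (golden_sub1_neq0 hd)).
  by rewrite mulr0 -[RHS](subrr 0) -{1}e1 -e3'; ring.
have al0 : al = 0.
  by move/eqP: e3; rewrite B0 rmorph0 addr0 fr_eq0 => /eqP.
by split.
Qed.

(** Free [u] and [v] cover the monomials and both binomial families, with terms in either order. *)
Lemma trinom_not_equivalent (s t : nat) (u v : L) (g : 'End(L)) :
    (s, t) \in [:: (1, 5); (1, 4); (2, 5)]%N -> (u != 0) || (v != 0) ->
    (forall x, g x = u * fr s x + v * fr t x) ->
  ~ equivalent (Lspan2 \1%VF (trinom c)) (Lspan2 \1%VF g).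
Proof.
move=> st uv gE /equivalent_trinom[d [phi [hd phi0 /Lspan2P[al [be ephi]]]]].
case/Lspan2P=> a [b e].
have phiE x : phi x = al * x + be * (u * fr s x + v * fr t x).
  by rewrite ephi LspanE gE.
have eE x : trinom d (al * x + be * (u * fr s x + v * fr t x))
            = a * x + b * (u * fr s x + v * fr t x).
  by rewrite -phiE -gE -LspanE -e comp_lfunE.
have [al0 bu bv] : [/\ al = 0, be * u = 0 & be * v = 0].
  move: st eE; rewrite !inE => /or3P[] /eqP[-> ->]; first exact: trinom_comp15.
    exact: trinom_comp14.
  exact: trinom_comp25.
case/eqP: phi0; apply/lfunP=> x.
by rewrite phiE mulrDr !mulrA al0 bu bv !mul0r !addr0 zero_lfunE.
Qed.

End Equivalence.

Theorem theorem1p1 (F : finFieldType) (L : splittingFieldType F)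
    (K2 K3 : {subfield L}) (c : L)
    (dimL : \dim {:L} = 6%N) (dimK2 : \dim K2 = 2%N) (dimK3 : \dim K3 = 3%N)
    (hc : c ^+ 2 + c = 1) :
  let q := #|F| in
  let C := Lspan2 \1%VF (qmonom L 1 + qmonom L 3 + lscale c (qmonom L 5)) in
  ([/\ Fq_linear C, is_MRD C, code_dim C = 12%N, is_min_dist C 5
     & alg_isomorphic (left_idealiser C) L /\
       alg_isomorphic (right_idealiser C) (subvs_of K2)]
   <-> odd q)
  /\
  (odd q -> (q = 2 %[mod 5])%N \/ (q = 3 %[mod 5])%N ->
   [/\ forall s : nat, coprime s 6 ->
         ~ equivalent C (Lspan2 \1%VF (qmonom L s)),
       forall (s : nat) (delta : L), (s < 6)%N -> coprime s 6 ->
         galNorm 1%AS {:L} delta \notin [:: 0; 1] ->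
         ~ equivalent C
             (Lspan2 \1%VF (lscale delta (qmonom L s) + qmonom L (6 - s)))
     & forall (s : nat) (delta : L), coprime s 3 ->
         galNorm K3 {:L} delta \notin [:: 0; 1] ->
         let D := Lspan2 \1%VF (lscale delta (qmonom L s) + qmonom L (s + 3)) in
         is_MRD D -> ~ equivalent C D]).
Proof.
move=> q C; have -> : C = Lspan2 \1%VF (trinom c) by [].
have oddE : odd q = (2%:R != 0 :> L) by rewrite two_neq0.
split.
  split=> [[_ _ _ dist5 _] | q_odd]; last first.
    have two_nz : 2%:R != 0 :> L by rewrite -oddE.
    split; [exact: Lspan2_linear | exact: trinom_MRD | exact: code_dim_trinom
           | exact: trinom_min_dist | split; first exact: left_idealiser_iso].
    exact: right_idealiser_iso.
  rewrite oddE; apply/eqP=> two_z; case: (golden_fr hc) => c1.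
    exact: (not_min_dist_fixed dimL two_z hc c1 dist5).
  exact: (not_min_dist_moved dimL two_z hc c1 dist5).
move=> q_odd _; have two_nz : 2%:R != 0 :> L by rewrite -oddE.
have no_equiv := @trinom_not_equivalent F L dimL c hc.
have period s x : qmonom L s x = fr (s %% 6) x by rewrite -fr_qmonom fr_mod.
split=> [s s6 | s delta s_lt s6 _ | s delta s3 _ D _].
- have : ((s %% 6 == 1) || (s %% 6 == 5))%N.
    move: s6; rewrite -coprime_modl; have := ltn_pmod s (isT : 0 < 6)%N.
    by case: (s %% 6)%N => [|[|[|[|[|[|]]]]]].
  case/orP=> /eqP es.
    apply: (no_equiv 1%N 5%N 1 0) => [//||x]; first by rewrite oner_eq0.
    by rewrite period es; ring.
  apply: (no_equiv 1%N 5%N 0 1) => [//||x]; first by rewrite oner_eq0 orbT.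
  by rewrite period es; ring.
- have gE x : (lscale delta (qmonom L s) + qmonom L (6 - s)) x
      = delta * fr s x + fr (6 - s) x.
    by rewrite add_lfunE lscaleE !fr_qmonom.
  case: s s_lt s6 gE => [|[|[|[|[|[|]]]]]] // _ _ gE.
    apply: (no_equiv 1%N 5%N delta 1) => [//||x]; first by rewrite oner_eq0 orbT.
    by rewrite gE; ring.
  apply: (no_equiv 1%N 5%N 1 delta) => [//||x]; first by rewrite oner_eq0.
  by rewrite gE; ring.
have gE x : (lscale delta (qmonom L s) + qmonom L (s + 3)) x
    = delta * fr (s %% 6) x + fr ((s %% 6 + 3) %% 6) x.
  by rewrite add_lfunE lscaleE !period modnDml.
have : coprime (s %% 6) 3 by rewrite -coprime_modl modn_dvdm // coprime_modl.
(* The residues prime to 3 are 1, 2, 4, 5, and adding 3 modulo 6 pairs 1 with 4 and 2 with 5. *)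
move: (s %% 6)%N (ltn_pmod s (isT : 0 < 6)%N) gE => r.
case: r => [|[|[|[|[|[|]]]]]] // _ gE _.
- apply: (no_equiv 1%N 4%N delta 1) => [//||x]; first by rewrite oner_eq0 orbT.
  by rewrite gE; ring.
- apply: (no_equiv 2%N 5%N delta 1) => [//||x]; first by rewrite oner_eq0 orbT.
  by rewrite gE; ring.
- apply: (no_equiv 1%N 4%N 1 delta) => [//||x]; first by rewrite oner_eq0.
  by rewrite gE; ring.
apply: (no_equiv 2%N 5%N 1 delta) => [//||x]; first by rewrite oner_eq0.
by rewrite gE; ring.
Qed.
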